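(* For arbitrary $n,m\in\mathbb{N}$ with $n<m$, $\mathcal{H}(\tfrac1m)\subset\mathcal{H}(\tfrac nm)$.
   Context: $\mathbb{N}$ denotes the positive integers and $\langle x\rangle=x-[x]$ the fractional part of $x\in\mathbb{R}$. For $0<c<1$, $$\mathcal{H}(c)=\Big\{\alpha\in\mathbb{R}\;:\;\mathrm{card}\{1\le k\le N : \langle k\alpha\rangle<c\}\ge cN\ \text{ for all } N\in\mathbb{N}\Big\}.$$ The symbol $\subset$ denotes (not necessarily strict) inclusion. *)

(* Defs.v *)
From mathcomp Require Import all_boot all_order all_algebra.
From mathcomp Require Import classical_sets reals.

Set Implicit Arguments.
Unset Strict Implicit.
Unset Printing Implicit Defensive.

Import Order.TTheory GRing.Theory Num.Theory.

Local Open Scope ring_scope.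

Definition frac_part (R : realType) (x : R) : R := x - (Num.floor x)%:~R.

(* 'I_N.+1 is {0, ..., N}, hence the explicit 1 <= k. *)
Definition hit_count (R : realType) (c alpha : R) (N : nat) : nat :=
  #|[set k : 'I_N.+1 | (1 <= k)%N && (frac_part (k%:R * alpha) < c)]%SET|.

Local Open Scope classical_set_scope.

(* Only meant for 0 < c < 1. *)
Definition calH (R : realType) (c : R) : set R :=
  [set alpha : R | forall N : nat, (0 < N)%N ->
     c * N%:R <= (hit_count c alpha N)%:R].

(* Main.v *)
Require Import Defs.
From mathcomp Require Import all_boot all_order all_algebra.
From mathcomp Require Import classical_sets reals.
From mathcomp Require Import zify ring lra.

(** Only the fractional part of [alpha] matters, so let [0 <= alpha < 1]; for
    [alpha = 0] every term is a visit.  If [0 < alpha] and [alpha] is in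
    [calH (1/m)], the inequality at the last [N] with [N * alpha < 1] forces
      [1 / alpha = m * q + 1 / x]  with [q] natural and [1 <= x]
    ([heavy_inv]): the first partial quotient of [alpha] is divisible by [m],
    and [x] is the tail of the continued fraction after it.

    The visits [k * alpha] in [[i, i + c)] are the integers of
    [[i / alpha, (i + c) / alpha)], so the visits before level [J] are counted
    by differences of ceilings ([visits_ceil]).  With [c = n/m] the term [m * q]
    shifts both endpoints by integers, so the visits of [alpha] before level [J]
    exceed those of [x] by exactly [n * q * J], which is [c] times the excess in
    the number of terms ([visits_renorm]).  Hence the surplus of visits over
    [c * N] is the same for [alpha] and [x].  For [n = 1] this gives that [x] is
    again in [calH (1/m)], and for general [n] it reduces the inequality for
    [alpha] to one for [x] with fewer terms, so strong induction on the number
    of terms, over all [alpha] in [calH (1/m)] at once, finishes. *)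

Set Implicit Arguments.
Unset Strict Implicit.
Unset Printing Implicit Defensive.

Import Order.TTheory GRing.Theory Num.Theory.

Local Open Scope ring_scope.
Local Open Scope classical_set_scope.

(** * Ceilings with natural values *)

Definition nceil (R : realType) (y : R) : nat := `|Num.ceil y|%N.

(** This characterizes [nceil y] as the number of naturals below [y]. *)
Lemma ltn_nceil (R : realType) (y : R) (k : nat) :
  0 <= y -> (k < nceil y)%N = (k%:R < y).
Proof.
move=> y0; have c0 : 0 <= Num.ceil y by rewrite ceil_ge0; lra.
have -> : (k < nceil y)%N = (k%:Z < Num.ceil y) by rewrite /nceil; lia.
by rewrite ceil_gt_int -pmulrn.
Qed.

Lemma nceil_eq (R : realType) (y : R) (p : nat) : 0 <= y ->
  (forall k : nat, (k < p)%N = (k%:R < y)) -> nceil y = p.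
Proof.
move=> y0 h; apply/eqP; rewrite eqn_leq; apply/andP; split.
  by rewrite leqNgt ltn_nceil // -h ltnn.
by rewrite leqNgt h -ltn_nceil // ltnn.
Qed.

Lemma leq_nceil (R : realType) (y z : R) :
  0 <= y -> y <= z -> (nceil y <= nceil z)%N.
Proof.
move=> y0 yz; rewrite leqNgt; apply/negP; rewrite ltn_nceil // => h.
have := lt_le_trans h yz; rewrite -ltn_nceil ?ltnn //; exact: le_trans yz.
Qed.

Lemma nceilDn (R : realType) (y : R) (p : nat) :
  0 <= y -> nceil (p%:R + y) = (p + nceil y)%N.
Proof.
move=> y0; apply: nceil_eq => [|k]; first by rewrite addr_ge0.
have [kp|pk] := ltnP k p.
  have -> : (k < p + nceil y)%N by lia.
  by apply/esym; rewrite ltr_wpDr // ltr_nat.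
rewrite -[in RHS](subnKC pk) natrD ltrD2l -ltn_nceil //.
by rewrite ltn_subLR.
Qed.

(** * Counting visits *)

(** Visits are counted from the term [k = 0], so that the terms below a level
    [J] form the whole range [k < nceil (J / alpha)]. *)
Definition visits (R : realType) (c alpha : R) (M : nat) : nat :=
  \sum_(0 <= k < M) (frac_part (k%:R * alpha) < c)%R.

Lemma visitsS (R : realType) (c alpha : R) (N : nat) :
  0 < c -> visits c alpha N.+1 = (hit_count c alpha N).+1.
Proof.
move=> c0; rewrite /visits big_ltn // mul0r /frac_part floor0 subrr c0 add1n.
congr _.+1; rewrite /hit_count cardsE -sum1_card [RHS]big_mkcond /=.
rewrite -(big_mkord xpredT (fun k => if (1 <= k)%N &&
  (frac_part (k%:R * alpha) < c)%R then 1%N else 0%N)) /=.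
rewrite [RHS]big_ltn // add0n; apply: eq_big_nat => k /andP[k1 _].
by rewrite k1 /frac_part; case: (_ < c).
Qed.

Lemma calH_visits (R : realType) (c alpha : R) : 0 < c -> calH c alpha ->
  forall N, c * N%:R + 1 <= (visits c alpha N.+1)%:R :> R.
Proof.
move=> c0 h [|N]; rewrite visitsS // -[in leRHS]addn1 natrD lerD2r.
  by rewrite mulr0.
exact: h.
Qed.

(** * Fractional parts *)

Lemma frac_part_bounds (R : realType) (x : R) : 0 <= frac_part x < 1.
Proof.
have /andP[h1 h2] := floor_itv x; move: h2; rewrite intrD => h2.
rewrite /frac_part; lra.
Qed.

Lemma frac_part_floor (R : realType) (x : R) (i : nat) :
  i%:R <= x -> x < i%:R + 1 -> frac_part x = x - i%:R.
Proof.
move=> h1 h2; rewrite /frac_part (@floor_def _ _ i%:Z) ?pmulrn //.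
by rewrite intrD -!pmulrn h1 h2.
Qed.

Lemma frac_partM (R : realType) (a : R) (k : nat) :
  frac_part (k%:R * frac_part a) = frac_part (k%:R * a).
Proof.
have -> : k%:R * frac_part a = k%:R * a + (- (k%:Z * Num.floor a))%:~R.
  by rewrite /frac_part mulrBr intrN intrM -!pmulrn.
rewrite {1}/frac_part floorDrz ?intr_int // intrKfloor intrD /frac_part; lra.
Qed.

Lemma visits_frac (R : realType) (c a : R) (M : nat) :
  visits c (frac_part a) M = visits c a M.
Proof. by apply: eq_bigr => k _; rewrite frac_partM. Qed.

(** * Visits level by level *)

(** The terms with [i <= k * alpha < i + 1] are visits exactly when
    [k < (i + c) / alpha]. *)
Lemma visits_ceil (R : realType) (c alpha : R) (J : nat) :
  0 < c <= 1 -> 0 < alpha ->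
  visits c alpha (nceil (J%:R / alpha)) =
  (\sum_(i < J) (nceil ((i%:R + c) / alpha) - nceil (i%:R / alpha)))%N.
Proof.
move=> /andP[c0 c1] a0; elim: J => [|J IH].
  by rewrite mul0r big_ord0 /nceil ceil0 /visits big_geq.
have J0 : 0 <= J%:R :> R by [].
have le1 : (nceil (J%:R / alpha) <= nceil ((J%:R + c) / alpha))%N.
  apply: leq_nceil; first by rewrite divr_ge0 // ltW.
  by rewrite ler_pM2r ?invr_gt0 //; lra.
have le2 : (nceil ((J%:R + c) / alpha) <= nceil (J.+1%:R / alpha))%N.
  apply: leq_nceil; first by rewrite divr_ge0 //; lra.
  by rewrite ler_pM2r ?invr_gt0 // -natr1; lra.
rewrite big_ord_recr /= -IH /visits (big_cat_nat (leq0n _) (leq_trans le1 le2)) /=.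
congr (_ + _)%N; rewrite (big_cat_nat le1 le2) /=.
have level (k : nat) : (nceil (J%:R / alpha) <= k)%N ->
    (k < nceil (J.+1%:R / alpha))%N ->
    (frac_part (k%:R * alpha) < c) = (k < nceil ((J%:R + c) / alpha))%N.
  rewrite leqNgt !ltn_nceil ?divr_ge0 ?(ltW a0) //; last lra.
  rewrite !ltr_pdivlMr // -leNgt -natr1 => k1 k2.
  by rewrite (frac_part_floor k1 k2) ltrBlDl.
rewrite (@eq_big_nat _ _ _ _ _ _ (fun=> 1%N)) => [|k /andP[k1 k2]]; last first.
  by rewrite level ?k2 // (leq_trans k2).
rewrite sum_nat_const_nat muln1 [X in (_ + X)%N]big1_seq ?addn0 // => k.
rewrite mem_index_iota => /andP[_ /andP[k1 k2]].
by rewrite level // ?ltnNge ?k1 // (leq_trans le1).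
Qed.

Lemma nceil_renorm (R : realType) (alpha x : R) (m q J : nat) :
  0 < x -> alpha^-1 = (m * q)%:R + x^-1 ->
  nceil (J%:R / alpha) = (m * q * J + nceil (J%:R / x))%N.
Proof.
move=> x0 e; rewrite -nceilDn; last by rewrite divr_ge0 // ltW.
by rewrite e mulrDr -natrM [(J * _)%N]mulnC.
Qed.

(** The numerator [n] of [c] makes [c * m * q] an integer, so the shift by
    [m * q] passes through the ceilings. *)
Lemma visits_renorm (R : realType) (alpha x : R) (m n q J : nat) :
  (0 < n)%N -> (n <= m)%N -> 0 < alpha -> 0 < x ->
  alpha^-1 = (m * q)%:R + x^-1 ->
  visits (n%:R / m%:R) alpha (nceil (J%:R / alpha)) =
  (n * q * J + visits (n%:R / m%:R) x (nceil (J%:R / x)))%N.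
Proof.
move=> n0 nm a0 x0 e; have m0 : 0 < m%:R :> R by rewrite ltr0n; lia.
have c01 : 0 < (n%:R / m%:R : R) <= 1.
  have p0 : 0 < n%:R :> R by rewrite ltr0n.
  by rewrite divr_gt0 // ler_pdivrMr // mul1r ler_nat.
rewrite !visits_ceil //.
have -> : (n * q * J = \sum_(i < J) n * q)%N by rewrite sum_nat_const card_ord mulnC.
rewrite -big_split /=; apply: eq_bigr => i _.
have i0 : 0 <= (i%:R + n%:R / m%:R) / x.
  by apply: divr_ge0; rewrite ?addr_ge0 ?divr_ge0 // ltW.
rewrite (nceil_renorm _ x0 e).
have -> : (i%:R + n%:R / m%:R) / alpha =
    (m * q * i + n * q)%:R + (i%:R + n%:R / m%:R) / x.
  rewrite e natrD !natrM; field; rewrite !gt_eqF //.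
rewrite nceilDn //.
have := @leq_nceil R (i%:R / x) ((i%:R + n%:R / m%:R) / x).
rewrite divr_ge0 ?(ltW x0) // ler_pM2r ?invr_gt0 // lerDl.
move=> /(_ isT); have /andP[/ltW -> _] := c01.
by move=> /(_ isT) le_ceil; rewrite -addnA subnDl addnBA.
Qed.

(** * Renormalization of [calH (1/m)] *)

(** Since steps of size [x >= 1] visit each level at most once, every number of
    terms is the number of terms below some level. *)
Lemma nceil_level (R : realType) (x : R) (U : nat) : 1 <= x ->
  exists J : nat, nceil (J%:R / x) = U.+1.
Proof.
move=> x1; have x0 : 0 < x by lra.
have Ux : 0 <= U%:R * x by rewrite mulr_ge0 // ltW.
exists (Num.truncn (U%:R * x)).+1.
have /andP[h1 h2] := truncn_itv Ux.
apply: nceil_eq => [|k]; first by rewrite divr_ge0 // ltW.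
rewrite ltr_pdivlMr // ltnS; apply/idP/idP => [kU|].
  by apply: le_lt_trans h2; rewrite ler_pM2r // ler_nat.
apply: contraLR; rewrite -ltnNge -leNgt => Uk; rewrite -natr1.
have : U.+1%:R * x <= k%:R * x by rewrite ler_pM2r // ler_nat.
by rewrite -natr1 mulrDl; lra.
Qed.

(** The surplus of visits at level [1] is what bounds [1 / alpha - m * q] by
    [1]; the surplus at the other levels is inherited by [x]. *)
Lemma heavy_inv (R : realType) (m : nat) (alpha : R) :
  (0 < m)%N -> 0 < alpha ->
  (forall N, 1 / m%:R * N%:R + 1 <=
    (visits (1 / m%:R) alpha N.+1)%:R :> R) ->
  exists (q : nat) (x : R), [/\ 1 <= x, alpha^-1 = (m * q)%:R + x^-1 &
    calH (1 / m%:R) x].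
Proof.
move=> m_gt0 a0 h; have m0 : 0 < m%:R :> R by rewrite ltr0n.
have c0 : 0 < 1 / m%:R :> R by rewrite divr_gt0.
have h' M : (0 < M)%N -> (M + m <= m * visits (1 / m%:R) alpha M + 1)%N.
  case: M => // N _; have := h N.
  have e : m%:R * (1 / m%:R * N%:R + 1) = (N + m)%:R :> R.
    by rewrite natrD; field; rewrite gt_eqF.
  by rewrite -(ler_pM2l m0) e -natrM ler_nat addSn addn1 ltnS.
have ia0 : 0 < alpha^-1 by rewrite invr_gt0.
have C1 : (0 < nceil (1%:R / alpha))%N by rewrite ltn_nceil ?mul1r // ltW.
have c01 : 0 < (1 / m%:R : R) <= 1.
  by rewrite c0 ler_pdivrMr // mul1r (ler_nat _ 1 m).
have := h' _ C1; rewrite (visits_ceil _ c01 a0) big_ord1 add0r !mul0r.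
have -> : nceil (0 : R) = 0%N by rewrite /nceil ceil0.
rewrite subn0; set Q := nceil (1 / m%:R / alpha) => hQ.
have y0 : 0 < 1 / m%:R / alpha by rewrite divr_gt0.
have Qp : (0 < Q)%N by rewrite ltn_nceil // ltW.
pose q := Q.-1.
have hq : (m * q)%:R < alpha^-1.
  have : (q < Q)%N by rewrite /q; lia.
  rewrite ltn_nceil ?(ltW y0) //.
  by rewrite -(ltr_pM2l m0) -natrM mul1r mulVKf // gt_eqF.
have hq1 : alpha^-1 <= (m * q)%:R + 1.
  have : ~~ (m * q + 1 < nceil (1%:R / alpha))%N.
    by rewrite -leqNgt /q; move: hQ; rewrite -{1 2}(prednK Qp) mulnS; lia.
  by rewrite ltn_nceil ?mul1r ?(ltW ia0) // -leNgt natrD.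
pose x := (alpha^-1 - (m * q)%:R)^-1.
have d0 : 0 < alpha^-1 - (m * q)%:R by lra.
have x1 : 1 <= x by rewrite /x invf_ge1 //; lra.
have e : alpha^-1 = (m * q)%:R + x^-1 by rewrite /x invrK; lra.
exists q, x; split=> // U U0.
have [J hJ] := nceil_level U x1.
have x0 : 0 < x by lra.
have := visits_renorm J (isT : (0 < 1)%N) m_gt0 a0 x0 e.
rewrite mulr1n mul1n => eV.
have := h' (nceil (J%:R / alpha)); rewrite eV.
rewrite (nceil_renorm J x0 e) hJ visitsS // addnS => /(_ isT) hU.
rewrite mul1r in hU *; rewrite mulrC ler_pdivrMr // -natrM ler_nat.
by move: hU; nia.
Qed.

(** Strong induction on [N].  If the term [N] is a visit, the previous term
    suffices; if it is not, no visit follows until the next level, so the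
    number of terms may be increased up to that level, where it corresponds to
    a smaller number of terms for [x]. *)
Lemma heavy_visits (R : realType) (m n : nat) (N : nat) (alpha : R) :
  (0 < n)%N -> (n < m)%N -> calH (1 / m%:R) alpha ->
  (n * N + m <= m * visits (n%:R / m%:R) alpha N.+1)%N.
Proof.
move=> n0 nm; have m0 : 0 < m%:R :> R by rewrite ltr0n; lia.
have c0 : 0 < n%:R / m%:R :> R by rewrite divr_gt0 // ltr0n.
have c1 : n%:R / m%:R < 1 :> R by rewrite ltr_pdivrMr // mul1r ltr_nat.
have c0' : 0 < 1 / m%:R :> R by rewrite divr_gt0.
elim/ltn_ind: N alpha => -[|N] IH alpha ha.
  by rewrite visitsS // muln0 mulnS leq_addr.
have hN := IH N (ltnSn _) _ ha.
have [hit|miss] := ltP (frac_part (N.+1%:R * alpha)) (n%:R / m%:R).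
  rewrite /visits big_nat_recr //= hit -/(visits _ _ _); nia.
rewrite -visits_frac; rewrite -frac_partM in miss.
have hb N' : 1 / m%:R * N'%:R + 1 <=
    (visits (1 / m%:R) (frac_part alpha) N'.+1)%:R :> R.
  by rewrite visits_frac; exact: calH_visits.
have /andP[a0 a1] := frac_part_bounds alpha.
move: a0 a1 miss hb; set a := frac_part alpha => a0 a1 miss hb.
have {}a0 : 0 < a.
  rewrite lt_neqAle a0 andbT eq_sym; apply/eqP => az.
  by move: miss; rewrite az mulr0 /frac_part floor0 subrr; lra.
have [q [x [x1 e hx]]] := heavy_inv (leq_trans n0 (ltnW nm)) a0 hb.
have x0 : 0 < x by lra.
pose J := Num.truncn (N.+1%:R * a).
have Na : 0 <= N.+1%:R * a by rewrite mulr_ge0 // ltW.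
have /andP[J1 J2] := truncn_itv Na; rewrite -/J in J1 J2.
rewrite -[J.+1%:R]natr1 in J2.
have JN : (J < N.+1)%N.
  by rewrite -(ltr_nat R); apply: le_lt_trans J1 _; rewrite gtr_pMr ?ltr0n.
rewrite (@frac_part_floor _ _ J) // in miss.
set M := nceil (J.+1%:R / a).
have NM : (N.+2 <= M)%N.
  rewrite /M ltn_nceil; last by rewrite divr_ge0 // ltW.
  by rewrite ltr_pdivlMr // -[J.+1%:R]natr1.
have late (k : nat) : (N.+1 <= k)%N -> (k < M)%N ->
    (frac_part (k%:R * a) < n%:R / m%:R) = false.
  move=> k1; rewrite /M ltn_nceil; last by rewrite divr_ge0 // ltW.
  rewrite ltr_pdivlMr // -[J.+1%:R]natr1 => k2.
  have k3 : N.+1%:R * a <= k%:R * a by rewrite ler_pM2r // ler_nat.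
  rewrite (frac_part_floor (le_trans J1 k3) k2).
  by apply/negbTE; rewrite -leNgt (le_trans miss) // lerB.
have vM : visits (n%:R / m%:R) a M = visits (n%:R / m%:R) a N.+2.
  rewrite /visits (big_cat_nat (leq0n _) NM) /= [X in (_ + X)%N]big1_seq ?addn0 //.
  move=> k; rewrite mem_index_iota => /andP[_ /andP[k1 k2]].
  by rewrite late // ltnW.
have := visits_renorm J.+1 n0 (ltnW nm) a0 x0 e.
have := nceil_renorm J.+1 x0 e; rewrite -/M => eM; rewrite vM => ->.
have U0 : (0 < nceil (J.+1%:R / x))%N.
  by rewrite ltn_nceil ?divr_gt0 // divr_ge0 // ltW.
have UJ : (nceil (J.+1%:R / x) <= J.+1)%N.
  rewrite leqNgt ltn_nceil; last by rewrite divr_ge0 // ltW.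
  by rewrite -leNgt ler_pdivrMr // ler_peMr.
move: eM U0 UJ; case: (nceil (J.+1%:R / x)) => // U eM _ UJ.
have := IH U (leq_ltn_trans (UJ : (U <= J)%N) JN) _ hx.
have : (n * N.+2 <= n * M)%N by rewrite leq_mul2l NM orbT.
by rewrite eM; nia.
Qed.

Theorem mainTheorem7 (R : realType) (n m : nat) (n_gt0 : (0 < n)%N)
    (n_lt_m : (n < m)%N) :
  calH (1 / m%:R : R) `<=` calH (n%:R / m%:R : R).
Proof.
move=> alpha ha N _.
have m0 : 0 < m%:R :> R by rewrite ltr0n; lia.
have := heavy_visits N n_gt0 n_lt_m ha.
rewrite visitsS; last by rewrite divr_gt0 // ltr0n.
rewrite mulnS addnC leq_add2l => h.
by rewrite mulrAC ler_pdivrMr // -!natrM ler_nat mulnC [leqRHS]mulnC; lia.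
Qed.
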